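(* In the setting of the context (a weighted genus two admissible cover over the standard log point, with real-metrised tropicalisation $\Gamma$, associated function $\lambda$, and $\rho_1$ the value of $\lambda$ on the special vertex or vertices), the subcurve $\Gamma_{\ge\rho_1}=\{x\in\Gamma:\lambda(x)\ge\rho_1\}$ contains the core, i.e. the minimal subcurve of genus two of $\Gamma$.
   Context: *Admissible cover.* Over $\mathbb C$, let $\psi\colon(C,D_R)\to(T,D_B)$ be a hyperelliptic admissible cover: a finite degree two morphism of nodal curves, $C$ connected of arithmetic genus $2$, $T$ of genus $0$, étale on $C^{sm}\setminus D_R$, simply ramified along the six smooth points $D_R$ mapping to six distinct smooth points $D_B$, mapping nodes to nodes with the same ramification order $1$ or $2$ on both branches. It carries a weight $w\colon V(\Gamma)\to\mathbb N$ on the dual graph of $C$, not identically zero, such that with $w_T(v)=\sum_{v'\mapsto v}w(v')$ every component of $T$ with $w_T=0$ has at least three nodes or branch points. *Metric.* $\Gamma=\mathrm{trop}(C)$ and the tree $\Gamma_T=\mathrm{trop}(T)$ are the dual graphs with positive real edge lengths, where the length of an edge of $\Gamma_T$ is the ramification order (expansion factor) times the length of any edge of $\Gamma$ above it; $\mathrm{trop}(\psi)\colon\Gamma\to\Gamma_T$ is the induced harmonic map of degree two. For a subcurve, genus means arithmetic genus: first Betti number plus sum of vertex genera. *Functions.* A piecewise linear (PL) function has integral slopes on (a subdivision of) $\Gamma$ (half-integral slopes allowed on $\Gamma_T$); $\mathrm{div}(\lambda)(v)$ is the sum of outgoing slopes at $v$; $K_\Gamma(v)=2g(v)-2+\mathrm{val}(v)$.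 Pullback along $\mathrm{trop}(\psi)$ composes functions and multiplies divisors by local degrees. On $\Gamma_T$ let $D'(v)=\mathrm{val}(v)-2+\tfrac12\deg(D_B|_v)$ (valence counts edges only); it has degree $1$ and pulls back to $K_\Gamma$. For each vertex $v_0$ of $\Gamma_T$ there is a PL function $\overline\lambda_T$, unique up to constants, with $D'+\mathrm{div}(\overline\lambda_T)=v_0$; its pullback to $\Gamma$ is an *admissible function*. Let $\overline\lambda_1,\dots,\overline\lambda_s$ be all of them and let $\lambda_i$ be $\overline\lambda_i$ shifted by a constant so that vertices with $\lambda_i>0$ have weight $0$ while those with $\lambda_i\ge0$ have total weight $\ge1$ (i.e. the maximum of $\lambda_i$ on vertices of positive weight is $0$). Define $\lambda=\max\{0,\lambda_1,\dots,\lambda_s\}$, a PL function on a subdivision of $\Gamma$, pulled back from $\lambda_T$ on $\Gamma_T$. Put $\Delta^\circ=\{\lambda>0\}$ and let $\Delta$ be the minimal subcurve of genus two containing the closure of $\Delta^\circ$, $\Delta_T$ its image in $\Gamma_T$. With $D'$ computed using valences in $\Delta_T$, $D=D'+\mathrm{div}(\lambda_T)$ is an effective divisor of degree $1$ with half-integral coefficients on $\Delta_T$ and $\mathrm{trop}(\psi)^*D=K_\Delta+\mathrm{div}(\lambda)$ on $\Delta$. The point(s) supporting $D$, and their preimages in $\Gamma$, are called special; if $D$ is half the sum of two distinct points then $\lambda$ is $0$ at both, so the value $\rho_1\ge0$ of $\lambda$ on the special vertex(ices) is well defined. *)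

(* Defs.v *)
From HB Require Import structures.
From mathcomp Require Import all_boot all_order all_algebra.
From mathcomp Require Import boolp classical_sets functions reals.
From mathcomp Require Import topology normedtype.

Set Implicit Arguments.
Unset Strict Implicit.
Unset Printing Implicit Defensive.

Import Order.TTheory GRing.Theory Num.Theory numFieldNormedType.Exports.

Local Open Scope classical_set_scope.
Local Open Scope ring_scope.

(* Finite graphs with edge lengths; the orientation is auxiliary, loops and
   multiple edges are allowed. *)
Record mgraph (R : realType) := MGraph {
  vert : finType;
  edge : finType;
  src : edge -> vert;
  tgt : edge -> vert;
  len : edge -> R;
  len_gt0 : forall e, 0 < len e }.

Section MetricGraph.
Context {R : realType}.
Implicit Type G : mgraph R.

(* A point of the metric realization: a vertex, or an edge e together with an
   arc-length coordinate in the open interval ]0, len e[ measured from src e. *)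
Definition gpoint G : Type :=
  (vert G + {et : edge G * R | (0 < et.2 < len et.1)%R})%type.

HB.instance Definition _ G := Choice.on (gpoint G).

Definition vtx G (v : vert G) : gpoint G := inl v.

(* The point at coordinate t on the closed edge e; t is clamped to
   [0, len e], so that 0 gives src e and len e gives tgt e. *)
Definition epoint G (e : edge G) (t : R) : gpoint G :=
  match insub (e, t) with
  | Some i => inr i
  | None => if t <= 0 then inl (src e) else inl (tgt e)
  end.

(* The final topology for the edge parametrizations: since they are clamped,
   this is the quotient topology of the disjoint union of the vertices and of
   the closed segments [0, len e]. *)
Definition gopen G (U : set (gpoint G)) : Prop :=
  forall e : edge G, open (epoint e @^-1` U).

Lemma gopenT G : gopen [set: gpoint G].
Proof. by move=> e; rewrite preimage_setT; exact: openT. Qed.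

Lemma gopenI G : setI_closed (@gopen G).
Proof. by move=> U W oU oW e; rewrite preimage_setI; exact: openI. Qed.

Lemma gopen_bigU G (I : Type) (f : I -> set (gpoint G)) :
  (forall i, gopen (f i)) -> gopen (\bigcup_i f i).
Proof.
by move=> of_ e; rewrite preimage_bigcup; apply: bigcup_open => i _; exact: of_.
Qed.

HB.instance Definition _ G :=
  isOpenTopological.Build (gpoint G) (@gopenT G) (@gopenI G) (@gopen_bigU G).

(* (e, false) leaves src e along e, and (e, true) leaves tgt e along e. *)
Definition halfedge G : finType := (edge G * bool)%type.

Definition hend G (h : halfedge G) : vert G :=
  if h.2 then tgt h.1 else src h.1.

(* The tangent directions at x. At an interior point of e there are two of
   them: (e, false) for increasing and (e, true) for decreasing coordinate. *)
Definition tangent G (x : gpoint G) : {set halfedge G} :=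
  match x with
  | inl v => [set h | hend h == v]%SET
  | inr i => [set h | h.1 == (val i).1]%SET
  end.

Definition coord_at G (x : gpoint G) (h : halfedge G) : R :=
  match x with
  | inl _ => if h.2 then len h.1 else 0
  | inr i => (val i).2
  end.

(* The point at (small) distance t from x in the direction h. *)
Definition move_to G (x : gpoint G) (h : halfedge G) (t : R) : gpoint G :=
  epoint h.1 (if h.2 then coord_at x h - t else coord_at x h + t).

Definition in_dir G (S : set (gpoint G)) (x : gpoint G) (h : halfedge G) :
    Prop :=
  \forall t \near 0^'+, S (move_to x h t).

(* The valence of x in S: for x in a subgraph S of a subdivision of G, the
   number of edges of S at x. *)
Definition val_in G (S : set (gpoint G)) (x : gpoint G) : nat :=
  #|[set h in tangent x | `[< in_dir S x h >]]%SET|.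

(* f is affine, with slope in L, on each closed piece of an edge whose interior
   avoids a finite set bs of breakpoints; in particular f is continuous. *)
Definition piecewise_linear G (L : set R) (f : gpoint G -> R) : Prop :=
  forall e : edge G, exists bs : seq R, forall a b : R,
    0 <= a -> a < b -> b <= len e ->
    (forall c, c \in bs -> ~~ (a < c < b)) ->
    exists2 m, L m &
      forall t, a <= t <= b -> f (epoint e t) = f (epoint e a) + m * (t - a).

Definition half_integral : set R := [set m | 2 * m \is a Num.int].

Definition slope_at G (f : gpoint G -> R) (x : gpoint G) (h : halfedge G) : R :=
  xget 0 [set m | \forall t \near 0^'+, f (move_to x h t) = f x + m * t].

Definition gdiv G (f : gpoint G -> R) (x : gpoint G) : R :=
  \sum_(h in tangent x) slope_at f x h.

Definition adj G (F : {set edge G}) : rel (vert G) := fun u v =>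
  [exists e in F, ((src e == u) && (tgt e == v)) ||
                  ((src e == v) && (tgt e == u))].

Definition graph_connected G : Prop :=
  forall u v : vert G, connect (adj [set: edge G]%SET) u v.

(* First Betti number of the subgraph with vertices W and edges F. *)
Definition betti1 G (W : {set vert G}) (F : {set edge G}) : nat :=
  (#|F| + n_comp (adj F) W - #|W|)%N.

Definition arith_genus G (g : vert G -> nat)
    (W : {set vert G}) (F : {set edge G}) : nat :=
  (betti1 W F + \sum_(v in W) g v)%N.

(* In a finite metric graph, the non-empty closed connected subsets are exactly
   the connected subgraphs of subdivisions. *)
Definition subcurve G (S : set (gpoint G)) : Prop :=
  [/\ S !=set0, closed S & connected S].

(* The arithmetic genus of a subcurve. Segments of S that do not fill an edge
   of G are contractible and contribute neither cycles nor vertex genera, so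
   only the vertices and whole edges of G lying in S matter. *)
Definition genus_of G (g : vert G -> nat) (S : set (gpoint G)) : nat :=
  arith_genus g [set v | `[< S (vtx v) >]]%SET
                [set e | `[< forall t, S (epoint e t) >]]%SET.

(* S is the minimal subcurve of genus two containing K. *)
Definition min_genus2 G (g : vert G -> nat) (K S : set (gpoint G)) : Prop :=
  [/\ subcurve S, genus_of g S = 2%N, K `<=` S &
      forall S', subcurve S' -> genus_of g S' = 2%N -> K `<=` S' -> S `<=` S'].

Definition core_of G (g : vert G -> nat) (S : set (gpoint G)) : Prop :=
  min_genus2 g set0 S.

End MetricGraph.

(* The tropicalization of a weighted hyperelliptic admissible cover
   (C, D_R) -> (T, D_B) of genus two: dual graphs of C and T, with the degrees
   of the maps between components, the ramification orders at the nodes, and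
   the components carrying the ramification and branch points. The edges of
   [curve] are oriented compatibly with those of [target]. The i-th points of
   D_R and D_B lie on the components [ram i] and [br i]. *)
Record admissible_cover (R : realType) := AdmissibleCover {
  curve : mgraph R;
  target : mgraph R;
  vgenus : vert curve -> nat;
  weight : vert curve -> nat;
  vmap : vert curve -> vert target;
  emap : edge curve -> edge target;
  vdeg : vert curve -> nat;
  edeg : edge curve -> nat;
  ram : 'I_6 -> vert curve;
  br : 'I_6 -> vert target;
  curve_connected : graph_connected curve;
  curve_genus : arith_genus vgenus [set: vert curve]%SET [set: edge curve]%SET = 2%N;
  target_connected : graph_connected target;
  (* all components of T are rational *)
  target_genus : betti1 [set: vert target]%SET [set: edge target]%SET = 0%N;
  src_emap : forall e, src (emap e) = vmap (src e);
  tgt_emap : forall e, tgt (emap e) = vmap (tgt e);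
  edeg12 : forall e, (edeg e == 1%N) || (edeg e == 2%N);
  len_emap : forall e, len (emap e) = (edeg e)%:R * len e;
  vdeg_gt0 : forall v, (0 < vdeg v)%N;
  vdeg_sum : forall y, (\sum_(v | vmap v == y) vdeg v = 2)%N;
  harmonic_src : forall v (f : edge target), src f = vmap v ->
    (\sum_(e | (src e == v) && (emap e == f)) edeg e = vdeg v)%N;
  harmonic_tgt : forall v (f : edge target), tgt f = vmap v ->
    (\sum_(e | (tgt e == v) && (emap e == f)) edeg e = vdeg v)%N;
  br_ram : forall i, vmap (ram i) = br i;
  vdeg_ram : forall i, vdeg (ram i) = 2%N;
  (* 2 g(v) - 2 = - 2 deg(v) + (degree of the ramification divisor on v): the
     cover is simply ramified along D_R, ramified to order [edeg] at the nodes
     and etale elsewhere *)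
  riemann_hurwitz : forall v,
    ((vgenus v).*2 + (vdeg v).*2 =
     2 + #|[set i | ram i == v]%SET| +
     \sum_(h : halfedge curve | hend h == v) (edeg h.1 - 1))%N;
  weight_neq0 : exists v, weight v <> 0%N;
  stability : forall y : vert target,
    (\sum_(v | vmap v == y) weight v = 0)%N ->
    (3 <= #|tangent (vtx y)| + #|[set i | br i == y]%SET|)%N }.

Section Cover.
Context {R : realType} (C : admissible_cover R).

Definition trop_map (x : gpoint (curve C)) : gpoint (target C) :=
  match x with
  | inl v => vtx (vmap v)
  | inr i => epoint (emap (val i).1) ((edeg (val i).1)%:R * (val i).2)
  end.

Definition dilated (f : edge (target C)) : bool :=
  [exists e, (emap e == f) && (edeg e == 2%N)].

(* D'(x) = val(x) - 2 + deg(D_B|x) / 2, computed on a subcurve S of the target.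
   The valence is the one in S, and D_B is the branch divisor of the restriction
   of the cover to S, which has one extra branch point for each edge leaving S
   over which the cover is ramified (otherwise the degree would fall below 1 and
   D' would not pull back to the canonical divisor of the preimage of S). For
   S = setT there is no such edge. *)
Definition branch_deg (S : set (gpoint (target C))) (x : gpoint (target C)) :
    nat :=
  (#|[set i | vtx (br C i) == x]%SET| +
   #|[set h in tangent x | dilated h.1 && ~~ `[< in_dir S x h >]]%SET|)%N.

Definition Dprime (S : set (gpoint (target C))) (x : gpoint (target C)) : R :=
  (val_in S x)%:R - 2 + (branch_deg S x)%:R / 2.

(* The pullback of f to the curve is the admissible function attached to v0. *)
Definition admissible_fun (v0 : vert (target C)) (f : gpoint (target C) -> R) :
    Prop :=
  piecewise_linear half_integral f /\
  forall x, Dprime setT x + gdiv f x = (x == vtx v0)%:R.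

(* The choice of the additive constant, for the pullback of f to the curve. *)
Definition normalized (f : gpoint (target C) -> R) : Prop :=
  (forall v : vert (curve C), 0 < f (trop_map (vtx v)) -> weight v = 0%N) /\
  (1 <= \sum_(v : vert (curve C) | (0 <= f (trop_map (vtx v)))%R) weight v)%N.

Variable lam : vert (target C) -> gpoint (target C) -> R.

Definition lambdaT (x : gpoint (target C)) : R :=
  \big[Order.max/0]_(v0 : vert (target C)) lam v0 x.

Definition lambda (x : gpoint (curve C)) : R := lambdaT (trop_map x).

Definition Delta_open : set (gpoint (curve C)) := [set x | 0 < lambda x].

Definition is_Delta (Delta : set (gpoint (curve C))) : Prop :=
  min_genus2 (@vgenus R C) (closure Delta_open) Delta.

Definition Ddiv (Delta : set (gpoint (curve C))) (x : gpoint (target C)) : R :=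
  Dprime (trop_map @` Delta) x + gdiv lambdaT x.

Definition special (Delta : set (gpoint (curve C))) (x : gpoint (curve C)) :
    Prop :=
  (trop_map @` Delta) (trop_map x) /\ Ddiv Delta (trop_map x) <> 0.

End Cover.

(* Main.v *)
(** On the tree T, the slope of the admissible function attached to v0 along an
    edge, in the direction away from v0, is b/2 - 1, where b is the number of
    branch points beyond the edge. By Riemann-Hurwitz, a side of an edge carrying
    at least five branch points has a connected preimage of genus two; hence a
    point of the core always has at least two branch points beyond each edge that
    separates it from another point, and the function attached to v0 does not
    decrease on the way from a point x to the core unless that way goes towards
    v0. Now let x be special with lambda(x) > 0 and y in the core. If each
    admissible function attaining the maximum at x were attached to a vertex in
    the direction of y, all of them would have the same slopes at x, so lambda
    would agree near x with one of them and D(x) would vanish. So one of them is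
    nondecreasing from x to y. *)

Require Import Defs.
From mathcomp Require Import all_boot all_order all_algebra.
From mathcomp Require Import boolp classical_sets functions reals.
From mathcomp Require Import topology normedtype.
From mathcomp Require Import zify ring lra.

Set Implicit Arguments.
Unset Strict Implicit.
Unset Printing Implicit Defensive.

Import Order.TTheory GRing.Theory Num.Theory numFieldNormedType.Exports.

Local Open Scope classical_set_scope.
Local Open Scope ring_scope.

(** * Connectivity in finite graphs and the two sides of an edge *)

Section Graph.
Context {R : realType}.
Implicit Types G : mgraph R.

Lemma adj_edge G (F : {set edge G}) e : e \in F -> adj F (src e) (tgt e).
Proof. by move=> eF; apply/existsP; exists e; rewrite eF !eqxx. Qed.

Lemma adj_sym G (F : {set edge G}) : symmetric (adj F).
Proof. by move=> u v; apply: eq_existsb => e; rewrite orbC. Qed.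

Lemma adj_connect_sym G (F : {set edge G}) : connect_sym (adj F).
Proof. exact/sym_connect_sym/adj_sym. Qed.

(** Induction along a path. It is mostly applied to a boolean [f], to spread a property from one
    vertex over its connected component. *)
Lemma connect_invariant G (F : {set edge G}) (T : Type) (f : vert G -> T) u v :
  (forall e, e \in F -> f (src e) = f (tgt e)) ->
  connect (adj F) u v -> f u = f v.
Proof.
move=> fF /connectP[p + ->]; elim: p u => //= w p IHp u /andP[/existsP[e]].
case/andP=> /fF fe /orP[] /andP[/eqP<- /eqP<-] /IHp <- //.
Qed.

Lemma connect_edge G (F : {set edge G}) u e : e \in F ->
  connect (adj F) u (src e) = connect (adj F) u (tgt e).
Proof.
move=> eF; apply: (same_connect_r (adj_connect_sym F)).
exact/connect1/adj_edge.
Qed.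

(** A vertex set grows from [r] one vertex at a time, and each new vertex brings an edge of [F]
    joining it to the earlier ones. *)
Lemma card_connected_edges G (W : {set vert G}) (F : {set edge G}) r :
  r \in W -> {in W, forall v, connect (adj F) r v} ->
  (#|W| <= #|F|.+1)%N.
Proof.
move=> rW connW.
suff grow k : (k < #|W|)%N -> exists U : {set vert G},
    [/\ r \in U, #|U| = k.+1 &
        (k <= #|[set e in F | (src e \in U) && (tgt e \in U)]|)%N].
  have W0 : (0 < #|W|)%N by apply/card_gt0P; exists r.
  have /grow[U [_ _ le]] : (#|W|.-1 < #|W|)%N by rewrite prednK.
  rewrite -(prednK W0) ltnS; apply: leq_trans le _.
  by apply: subset_leq_card; apply/fintype.subsetP => e; rewrite inE => /andP[].
elim: k => [|k IHk] kW.
  by exists [set r]%SET; rewrite cards1 inE eqxx.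
have [U [rU cU le]] := IHk (ltnW kW).
(* If no edge of [F] left [U], then [U] would contain everything reachable from [r], hence [W],
   which has more elements. *)
have [e eF crossU] : exists2 e, e \in F & (src e \in U) != (tgt e \in U).
  apply: contrapT => nocross.
  suff /subset_leq_card : W \subset U by rewrite cU leqNgt kW.
  apply/fintype.subsetP => v /connW /(connect_invariant (f := fun w => w \in U)) <- //= e eF.
  by apply/eqP/negPn/negP => ne; apply: nocross; exists e.
pose w := if src e \in U then tgt e else src e.
have wU : w \notin U.
  by move: crossU; rewrite /w; case: ifP => [|/negbT //] _; case: (_ \in U).
exists (w |: U)%SET; split; first by rewrite inE rU orbT.
  by rewrite cardsU1 wU cU.
apply: leq_ltn_trans le _; apply: proper_card; apply/properP; split.
  apply/fintype.subsetP => e'; rewrite !inE => /andP[-> /andP[-> ->]].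
  by rewrite !orbT.
exists e; last by rewrite inE eF /=; move: crossU; do 2!case: (_ \in U).
rewrite !inE eF /=; move: crossU; rewrite /w.
by case: ifP => //= sU; case: (_ \in U) => //=; rewrite ?eqxx ?orbT.
Qed.

Lemma n_comp_connected G (W : {set vert G}) (F : {set edge G}) r :
  (forall v, (v \in W) = connect (adj F) r v) -> n_comp (adj F) W = 1%N.
Proof.
move=> WE; rewrite -(n_comp_connect (adj_connect_sym F) r).
exact: eq_n_comp_r.
Qed.

(* Whether v lies on the tgt e side of the edge e. *)
Definition side G (e : edge G) (v : vert G) : bool :=
  ~~ connect (adj (~: [set e])%SET) (src e) v.

Definition verts_on G (e : edge G) (b : bool) : {set vert G} :=
  [set v | side e v == b]%SET.

Definition edges_on G (e : edge G) (b : bool) : {set edge G} :=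
  [set e' | (e' != e) && (side e (src e') == b)]%SET.

(* The arc-length coordinate of the retraction of p onto the edge e. *)
Definition cut_coord G (e : edge G) (p : gpoint G) : R :=
  match p with
  | inl v => if side e v then len e else 0
  | inr i => if (val i).1 == e then (val i).2
             else if side e (src (val i).1) then len e else 0
  end.

Lemma side_src G (e : edge G) : side e (src e) = false.
Proof. by rewrite /side connect0. Qed.

Lemma side_edge G (e e' : edge G) : e' != e -> side e (src e') = side e (tgt e').
Proof. by move=> ne; rewrite /side connect_edge // !inE. Qed.

Lemma cut_coord_ge0 G (e : edge G) p : 0 <= cut_coord e p.
Proof.
have le := ltW (len_gt0 e).
case: p => [v|[[e' t] /= /andP[t0 _]]] /=; first by case: ifP.
by case: ifP => _; [exact: ltW|case: ifP].
Qed.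

Lemma cut_coord_le G (e : edge G) p : cut_coord e p <= len e.
Proof.
have le := ltW (len_gt0 e).
case: p => [v|[[e' t] /= /andP[_ t1]]] /=; first by case: ifP.
by case: eqP t1 => [<- /ltW //|_ _]; case: ifP.
Qed.

(** * Removing an edge from a tree *)

Section Tree.
Variable G : mgraph R.
Hypothesis connG : graph_connected G.
Hypothesis bettiG : betti1 [set: vert G]%SET [set: edge G]%SET = 0%N.

(** Subtraction in [betti1] is truncated, so its vanishing yields only an inequality; equality is
    recovered on each side of an edge in [card_side]. *)
Lemma tree_card (r : vert G) : (#|edge G| < #|vert G|)%N.
Proof.
move: bettiG; rewrite /betti1 (@n_comp_connected G _ _ r).
  by rewrite !cardsT; lia.
by move=> v; rewrite inE connG.
Qed.

(** Otherwise the graph would stay connected without [e], and would have too few edges for its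
    vertices. *)
Lemma side_tgt (e : edge G) : side e (tgt e) = true.
Proof.
apply/negP => ce; have := tree_card (src e); rewrite ltnNge => /negP; apply.
have := @card_connected_edges G [set: vert G]%SET (~: [set e])%SET (src e) (finset.in_setT _).
rewrite cardsC1 cardsT prednK; last by apply/card_gt0P; exists e.
apply=> v _; have -> // : connect (adj (~: [set e])%SET) (src e) v =
  connect (adj (~: [set e])%SET) (src e) (src e).
  apply: connect_invariant (connG v (src e)) => e' _.
  have [->|ne] := eqVneq e' e; first by rewrite connect0 ce.
  by rewrite connect_edge // !inE.
Qed.

Lemma side_hend (h : halfedge G) : side h.1 (hend h) = h.2.
Proof. by case: h => e []; rewrite /hend /= (side_src, side_tgt). Qed.

Lemma side_connect (e : edge G) u v : side e u = side e v ->
  connect (adj (~: [set e])%SET) u v.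
Proof.
have csym := adj_connect_sym (~: [set e])%SET.
(* Removing one edge leaves at most two components, those of its two ends. *)
have cov w : connect (adj (~: [set e])%SET) (src e) w ||
             connect (adj (~: [set e])%SET) (tgt e) w.
  rewrite -(@connect_invariant G [set: edge G]%SET _ (fun w =>
    connect (adj (~: [set e])%SET) (src e) w ||
    connect (adj (~: [set e])%SET) (tgt e) w) (src e) w) ?connect0 ?connG //.
  move=> e' _; have [->|ne] := eqVneq e' e; first by rewrite !connect0 orbT.
  by rewrite -!(@connect_edge _ _ _ e') // !inE.
rewrite /side; move: (cov u) (cov v).
case: (boolP (connect _ (src e) u)) => [cu|_] /=;
  case: (boolP (connect _ (src e) v)) => [cv|_] //=.
  by move=> _ _ _; apply: connect_trans cv; rewrite csym.
by move=> cu cv _; apply: connect_trans cv; rewrite csym.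
Qed.

(** A path from [u] to [v] avoiding [e] stays on a side of [e] that does not contain [e'], so it
    avoids [e'] too. *)
Lemma side_nested (e e' : edge G) u v : e' != e -> side e u = side e v ->
  side e u != side e (src e') -> side e' u = side e' v.
Proof.
move=> ne uv uNe'.
have := connect_invariant (f := fun w => (side e w == side e u) && side e' w)
  _ (side_connect uv).
rewrite eqxx uv eqxx; apply=> f; rewrite !inE => nef.
rewrite (side_edge nef); have [<-|nef'] := eqVneq e' f.
  by rewrite -(side_edge ne) eq_sym -uv (negPf uNe').
by rewrite (@side_edge _ e' f) // eq_sym.
Qed.

(** Each side is connected, which bounds its vertices by its edges plus one; the global count
    [tree_card] forces equality in both bounds. *)
Lemma card_side (e : edge G) b : #|verts_on e b| = #|edges_on e b|.+1.
Proof.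
have le b' : (#|verts_on e b'| <= #|edges_on e b'|.+1)%N.
  apply: (@card_connected_edges _ _ _ (hend (e, b'))).
    by rewrite inE (side_hend (e, b')).
  move=> v; rewrite inE => /eqP sv.
  have := connect_invariant (f := fun w => (side e w == b') &&
    connect (adj (edges_on e b')) (hend (e, b')) w) _
    (@side_connect e (hend (e, b')) v _).
  rewrite (side_hend (e, b')) sv eqxx connect0 /= => <- //.
  move=> e'; rewrite !inE => ne; rewrite -(side_edge ne).
  by case: eqP => //= se; rewrite connect_edge // inE ne se eqxx.
have := tree_card (src e).
have -> : #|vert G| = (#|verts_on e true| + #|verts_on e false|)%N.
  rewrite -cardsT -(cardsID (verts_on e true) [set: vert G]%SET) finset.setTI finset.setTD; congr addn.
  by apply: eq_card => v; rewrite !inE; case: side.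
have -> : #|edge G| = (#|edges_on e true| + #|edges_on e false|).+1.
  rewrite -cardsT (cardsD1 e) inE add1n; congr S.
  rewrite -(cardsID (edges_on e true)); congr addn; apply: eq_card => e'; rewrite !inE.
    by case: eqP.
  by case: eqP => //=; case: side.
by have := le true; have := le false; case: b; lia.
Qed.

(** An edge other than [e] has both halves on the same side, whereas [e] contributes one half to
    each. *)
Lemma big_halfedge_side (S : Type) (idx : S) (op : Monoid.com_law idx)
    (e : edge G) b (phi : halfedge G -> S) :
  \big[op/idx]_(h | side e (hend h) == b) phi h =
  op (\big[op/idx]_(e' in edges_on e b) op (phi (e', false)) (phi (e', true)))
     (phi (e, b)).
Proof.
rewrite big_mkcond (eq_bigr (fun h : halfedge G =>
  (fun e' b' => if side e (hend (e', b')) == b then phi (e', b') else idx) h.1 h.2));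
  last by case.
rewrite -(pair_bigA _ (fun e' b' => if side e (hend (e', b')) == b then phi (e', b') else idx)) /=.
rewrite (bigD1 e) //= Monoid.mulmC; congr (op _ _).
  rewrite [RHS]big_mkcond [LHS]big_mkcond; apply: eq_bigr => e' _.
  rewrite inE; case: eqVneq => //= ne; rewrite big_bool /=.
  rewrite /hend /= -(side_edge ne) Monoid.mulmC; case: eqP => // _.
  by rewrite Monoid.mulm1.
rewrite big_bool /= (side_hend (e, true)) (side_hend (e, false)).
by case: b; rewrite /= (Monoid.mulm1, Monoid.mul1m).
Qed.

End Tree.
End Graph.

(** * Slopes of piecewise linear functions on a metric graph *)

Section Slopes.
Context {R : realType}.
Implicit Types G : mgraph R.

Lemma epoint_in G (e : edge G) t (te : 0 < (e, t).2 < len (e, t).1) :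
  epoint e t = inr (exist _ (e, t) te).
Proof. by rewrite /epoint insubT. Qed.

Lemma epoint_le0 G (e : edge G) t : t <= 0 -> epoint e t = vtx (src e).
Proof. by move=> t0; rewrite /epoint insubN ?t0 //= ltNge t0. Qed.

Lemma epoint_ge_len G (e : edge G) t : len e <= t -> epoint e t = vtx (tgt e).
Proof.
move=> tl; rewrite /epoint insubN /= ?[t < _]ltNge ?tl ?andbF //.
by rewrite leNgt (lt_le_trans (len_gt0 e) tl).
Qed.

Lemma near_right0 (d : R) (P : R -> Prop) :
  0 < d -> (forall t, 0 < t < d -> P t) -> \forall t \near 0^'+, P t.
Proof.
move=> d0 Pd; near=> t; apply: Pd; apply/andP; split; near: t.
  exact: nbhs_right_gt.
exact: nbhs_right_lt.
Unshelve. all: by end_near. Qed.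

Lemma slope_atE G (f : gpoint G -> R) x h m :
  (\forall t \near 0^'+, f (move_to x h t) = f x + m * t) -> slope_at f x h = m.
Proof.
move=> fm; rewrite /slope_at; set S := [set m | _].
have fm' : S (xget 0 S) by apply: xgetPex; exists m.
move: (xget 0 S) fm' => m' fm'.
near (0 : R)^'+ => t.
have t0 : 0 < t by near: t; exact: nbhs_right_gt.
have e1 : f (move_to x h t) = f x + m * t by near: t; exact: fm.
have e2 : f (move_to x h t) = f x + m' * t by near: t; exact: fm'.
apply: (mulIf (lt0r_neq0 t0)) => /=; lra.
Unshelve. all: by end_near. Qed.

Definition eslope G (f : gpoint G -> R) (e : edge G) : R :=
  (f (vtx (tgt e)) - f (vtx (src e))) / len e.

Definition edge_affine G (f : gpoint G -> R) : Prop := forall e t,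
  0 <= t <= len e -> f (epoint e t) = f (vtx (src e)) + eslope f e * t.

Definition hslope G (f : gpoint G -> R) (h : halfedge G) : R :=
  if h.2 then - eslope f h.1 else eslope f h.1.

(* Harmonicity at the interior points of an edge removes the breakpoints one
   at a time. *)
Lemma harmonic_edge_affine G (L : set R) (f : gpoint G -> R) :
  piecewise_linear L f ->
  (forall i, gdiv f (inr i) = 0) -> edge_affine f.
Proof.
move=> plf harm e t.
have [bs] := plf e; elim: bs => [|c bs IHbs] affbs; last first.
  apply: IHbs => a b a0 ab bl avoid.
  have [acb|/negP nacb] := boolP (a < c < b); last first.
    apply: affbs => // d; rewrite inE => /orP[/eqP->|/avoid //].
    exact/negP.
  have /andP[ac cb] := acb.
  have outl d : d \in c :: bs -> ~~ (a < d < c).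
    rewrite inE => /orP[/eqP->|/avoid]; first by rewrite ltxx andbF.
    by apply: contra => /andP[-> /lt_trans->].
  have outr d : d \in c :: bs -> ~~ (c < d < b).
    rewrite inE => /orP[/eqP->|/avoid]; first by rewrite ltxx.
    by apply: contra => /andP[/(lt_trans ac)-> ->].
  have [m1 Lm1 aff1] := affbs a c a0 ac (ltW (lt_le_trans cb bl)) outl.
  have [m2 Lm2 aff2] := affbs c b (le_trans a0 (ltW ac)) cb bl outr.
  have ce : 0 < (e, c).2 < len (e, c).1.
    by rewrite /= (le_lt_trans a0 ac) (lt_le_trans cb bl).
  have fc : f (inr (exist _ (e, c) ce)) = f (epoint e a) + m1 * (c - a).
    by rewrite -epoint_in aff1 // lexx ltW.
  suff m12 : m2 = m1.
    exists m1 => // s /andP[as_ sb]; have [sc|cs] := leP s c.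
      by rewrite aff1 // as_ sc.
    rewrite aff2 ?sb ?ltW // epoint_in fc m12; ring.
  (* The outgoing slopes at the breakpoint are [m2] and [- m1]; harmonicity says that they
     cancel. *)
  have := harm (exist _ (e, c) ce); rewrite /gdiv.
  under eq_bigl do rewrite inE /=.
  rewrite (bigD1 (e, false)) //= (bigD1 (e, true)) /=; last by rewrite eqxx xpair_eqE andbF.
  rewrite big1 => [|[e' []] /= /andP[/andP[/eqP-> /negP]]]; rewrite ?eqxx //.
  rewrite (@slope_atE _ _ _ _ m2); last first.
    apply: (@near_right0 (b - c)); first by rewrite subr_gt0.
    move=> s sb; rewrite /move_to /= aff2; last lra.
    by rewrite epoint_in; congr (_ + _ * _); ring.
  rewrite (@slope_atE _ _ _ _ (- m1)); last first.
    apply: (@near_right0 (c - a)); first by rewrite subr_gt0.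
    move=> s sb; rewrite /move_to /= aff1; last lra.
    by rewrite fc; ring.
  by move/eqP; rewrite addr0 subr_eq0 => /eqP.
have [//|m _ aff] := affbs 0 (len e) (lexx _) (len_gt0 e) (lexx _).
move=> te; rewrite aff // epoint_le0 // subr0; congr (_ + _ * _).
have := aff (len e); rewrite epoint_ge_len // epoint_le0 // lexx ltW ?len_gt0 //.
move=> /(_ isT) ftgt; rewrite /eslope ftgt subr0.
have := len_gt0 e => l0; field; exact: lt0r_neq0.
Qed.

Lemma affine_move G (f : gpoint G -> R) p h : edge_affine f -> h \in tangent p ->
  \forall t \near 0^'+, f (move_to p h t) = f p + hslope f h * t.
Proof.
move=> aff; case: h => e b; have l0 := len_gt0 e.
have ftgt : f (vtx (tgt e)) = f (vtx (src e)) + eslope f e * len e.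
  by rewrite -aff ?lexx ?ltW // epoint_ge_len.
case: p => [v|[[e' s] ps]]; rewrite inE /move_to /hend /hslope /=.
  case: b => /eqP <-; apply: (near_right0 l0) => t te; rewrite aff; lra.
move=> /eqP ee'; subst e'; have /andP[/= s0 sl] := ps; rewrite -(epoint_in ps) (aff _ s); last lra.
case: b.
  by apply: (near_right0 s0) => t te; rewrite aff; [ring|lra].
apply: (@near_right0 (len e - s)); first by rewrite subr_gt0.
by move=> t te; rewrite aff; [ring|lra].
Qed.

Lemma cut_coord_epoint_neq G (e e' : edge G) t : e' != e ->
  cut_coord e (epoint e' t) = if side e (src e') then len e else 0.
Proof.
move=> ne; have [t0|t0] := leP t 0; first by rewrite epoint_le0.
have [tl|tl] := leP (len e') t; first by rewrite epoint_ge_len //= -side_edge.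
by rewrite (@epoint_in _ e' t) /= ?t0 // (negPf ne).
Qed.

Lemma cut_coord_epoint G (e : edge G) t :
  graph_connected G -> betti1 [set: vert G]%SET [set: edge G]%SET = 0%N ->
  0 <= t <= len e -> cut_coord e (epoint e t) = t.
Proof.
move=> connG bettiG te; have [t0|t0] := leP t 0.
  by rewrite epoint_le0 //= side_src; lra.
have [tl|tl] := leP (len e) t.
  by rewrite epoint_ge_len //= side_tgt //; lra.
by rewrite (@epoint_in _ e t) /= ?t0 // eqxx.
Qed.

(** The retraction coordinate on [e] varies only along [e]. Subtracting from [f] all these
    coordinates, weighted by the slopes, therefore leaves a function constant on every edge, hence
    constant. *)
Lemma affine_cut_sum G (f : gpoint G -> R) p q :
  graph_connected G -> betti1 [set: vert G]%SET [set: edge G]%SET = 0%N ->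
  edge_affine f ->
  f p - f q = \sum_e eslope f e * (cut_coord e p - cut_coord e q).
Proof.
move=> connG bettiG aff.
pose g x := f x - \sum_e eslope f e * cut_coord e x.
suff gpq : g p = g q.
  under eq_bigr do rewrite mulrBr; rewrite sumrB.
  move: gpq; rewrite /g => gpq; lra.
have gedge e t : 0 <= t <= len e -> g (epoint e t) = g (vtx (src e)).
  move=> te; rewrite /g aff // (bigD1 e) //= [in RHS](bigD1 e) //=.
  rewrite side_src mulr0 add0r.
  rewrite cut_coord_epoint //.
  rewrite (eq_bigr (fun e' => eslope f e' * if side e' (src e) then len e' else 0)).
    ring.
  by move=> e' ne; rewrite cut_coord_epoint_neq // eq_sym.
have gbase x : exists v, g x = g (vtx v).
  case: x => [v|[[e t] te]]; first by exists v.
  exists (src e); rewrite -(epoint_in te); apply: gedge.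
  by move: te => /= te; lra.
have [[u ->] [v ->]] := (gbase p, gbase q).
apply: (connect_invariant (f := g \o @vtx R G)) (connG u v) => e _ /=.
by rewrite -(gedge e (len e)) ?epoint_ge_len // lexx ltW ?len_gt0.
Qed.

End Slopes.

(** * Slopes of the admissible functions *)

Section Cover.
Context {R : realType} (C : admissible_cover R).
Local Notation T := (target C).

Definition branch_on (e : edge T) (b : bool) : nat :=
  #|[set i | side e (br C i) == b]%SET|.

Lemma branch_on_sum (e : edge T) : (branch_on e false + branch_on e true = 6)%N.
Proof.
rewrite /branch_on -[RHS](card_ord 6) -cardsT.
rewrite -(cardsID [set i | side e (br C i) == false]%SET [set: 'I_6]%SET).
by congr addn; apply: eq_card => i; rewrite !inE //; case: side.
Qed.

Lemma Dprime_full (S : set (gpoint T)) x :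
  {in tangent x, forall h, in_dir S x h} ->
  Dprime S x = #|tangent x|%:R - 2 + #|[set i | vtx (br C i) == x]%SET|%:R / 2.
Proof.
move=> full; rewrite /Dprime /val_in /branch_deg; congr (_ - 2 + (_)%:R / 2).
  congr (_ %:R); apply: eq_card => h; rewrite inE.
  by case: (boolP (h \in tangent x)) => //= /full/asboolP ->.
rewrite -[RHS]addn0; congr addn; apply/eqP; rewrite cards_eq0; apply/eqP/setP => h.
rewrite !inE; case: (boolP (h \in tangent x)) => //= /full/asboolP ->.
by rewrite andbF.
Qed.

Lemma in_dirT x (h : halfedge T) : in_dir setT x h.
Proof. exact: filterT. Qed.

(** At an interior point of an edge there are two directions and no branch point, so [Dprime]
    vanishes there and the function is harmonic. *)
Lemma admissible_affine v0 (f : gpoint T -> R) :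
  admissible_fun v0 f -> edge_affine f.
Proof.
case=> plf divf; apply: harmonic_edge_affine plf _ => i.
have := divf (inr i); rewrite Dprime_full => [|h _]; last exact: in_dirT.
have -> : #|tangent (inr i : gpoint T)| = 2%N.
  have -> : tangent (inr i : gpoint T) =
      [set ((val i).1, true); ((val i).1, false)]%SET.
    by apply/setP => -[e []]; rewrite !inE /= !xpair_eqE /= ?andbT ?andbF ?orbF.
  by rewrite cards2 xpair_eqE andbF.
have -> : #|[set j | vtx (br C j) == inr i]%SET| = 0%N.
  by apply/eqP; rewrite cards_eq0; apply/eqP/setP => j; rewrite !inE.
by rewrite mul0r subrr !add0r.
Qed.

(** The defining equation is summed over the vertices on the [src] side of [e]: slopes along the
    edges of that side cancel in pairs, and only the slope along [e] remains. *)
Lemma admissible_slope v0 (f : gpoint T -> R) e : admissible_fun v0 f ->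
  eslope f e = (~~ side e v0)%:R + 1 - (branch_on e false)%:R / 2.
Proof.
move=> admf; have aff := admissible_affine admf; case: admf => _ divf.
have connT := @target_connected R C; have bT := @target_genus R C.
have : \sum_(v | side e v == false) (Dprime setT (vtx v) + gdiv f (vtx v)) =
    (~~ side e v0)%:R.
  under eq_bigr do rewrite divf.
  have [s0|s0] := boolP (side e v0).
    rewrite big1 // => v /eqP sv; rewrite (_ : _ == _ = false) //.
    by apply/negbTE/eqP => -[ev]; rewrite ev s0 in sv.
  rewrite (bigD1 v0) ?(negbTE s0) //= eqxx big1 ?addr0 // => v /andP[_ ne].
  by rewrite (_ : _ == _ = false) //; apply/negbTE/eqP => -[/eqP]; apply/negP.
have local v : Dprime setT (vtx v) + gdiv f (vtx v) =
    \sum_(h : halfedge T | hend h == v) (1 + hslope f h) +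
    (- 2 + \sum_(i | br C i == v) 2^-1).
  rewrite Dprime_full => [|h _]; last exact: in_dirT.
  have -> : gdiv f (vtx v) = \sum_(h : halfedge T | hend h == v) hslope f h.
    rewrite /gdiv (eq_bigl (fun h : halfedge T => hend h == v)) => [|h]; last by rewrite inE.
    by apply: eq_bigr => h hv; apply/slope_atE/affine_move => //; rewrite inE.
  have -> : #|tangent (vtx v)|%:R = \sum_(h : halfedge T | hend h == v) 1 :> R.
    rewrite sumr_const; congr (_ %:R); apply: eq_card => h; by rewrite !inE.
  have -> : #|[set i | vtx (br C i) == vtx v]%SET|%:R / 2 =
      \sum_(i | br C i == v) 2^-1 :> R.
    rewrite sumr_const -[RHS]mulr_natl; congr (_ %:R * _).
    by apply: eq_card => i; rewrite !inE.
  by rewrite big_split /=; ring.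
under eq_bigr do rewrite local.
rewrite big_split /= big_split /=.
have -> : \sum_(v | side e v == false) \sum_(h : halfedge T | hend h == v) (1 + hslope f h)
    = \sum_(h : halfedge T | side e (hend h) == false) (1 + hslope f h).
  rewrite [RHS](partition_big (@hend R T) (fun v => side e v == false)) //=.
  apply: eq_bigr => v sv; apply: eq_bigl => h.
  by case: eqP => [->|]; rewrite ?sv ?andbF.
have -> : \sum_(v | side e v == false) \sum_(i | br C i == v) 2^-1
    = (branch_on e false)%:R / 2 :> R.
  have -> : (branch_on e false)%:R / 2 = \sum_(i | side e (br C i) == false) 2^-1 :> R.
    rewrite sumr_const -[RHS]mulr_natl; congr ((_)%:R * _).
    by apply: eq_card => i; rewrite !inE.
  rewrite [RHS](partition_big (br C) (fun v => side e v == false)) //=.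
  apply: eq_bigr => v sv; apply: eq_bigl => h.
  by case: eqP => [->|]; rewrite ?sv ?andbF.
rewrite big_halfedge_side // (eq_bigr (fun=> 2)) => [|e' _]; last first.
  by rewrite /hslope /=; ring.
(* The side is a tree, with one more vertex than edges. *)
have -> : \sum_(v | side e v == false) - 2 = - 2 * (#|edges_on e false|%:R + 1) :> R.
  rewrite natr1 -card_side // mulr_natr -sumr_const; apply: eq_bigl => v.
  by rewrite inE.
rewrite sumr_const /hslope /= -[2 *+ _]mulr_natl; lra.
Qed.

End Cover.

(** * The part of the curve lying over one side of an edge of the target *)

Lemma gpoint_openE (R : realType) (G : mgraph R) (U : set (gpoint G)) :
  open U = gopen U.
Proof. by []. Qed.

Section CoverGeometry.
Context {R : realType} (C : admissible_cover R).
Local Notation T := (target C).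

Lemma edeg_gt0 (e : edge (curve C)) : (0 < edeg e)%N.
Proof. by case/orP: (edeg12 e) => /eqP->. Qed.

Lemma trop_epoint (e : edge (curve C)) t :
  trop_map (epoint e t) = epoint (emap e) ((edeg e)%:R * t).
Proof.
have d0 : 0 < (edeg e)%:R :> R by rewrite ltr0n edeg_gt0.
have [t0|t0] := leP t 0.
  by rewrite !epoint_le0 ?pmulr_rle0 //= src_emap.
have [tl|tl] := leP (len e) t.
  by rewrite !epoint_ge_len ?len_emap ?ler_pM2l //= tgt_emap.
by rewrite (@epoint_in _ _ e t) /= ?t0.
Qed.

Lemma vmap_surj y : exists v : vert (curve C), vmap v = y.
Proof.
apply: contrapT => nov; have := vdeg_sum y; rewrite big1 // => v /eqP vy.
by case: nov; exists v.
Qed.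

Lemma edge_lift (v : vert (curve C)) (h : halfedge T) : hend h = vmap v ->
  exists e : edge (curve C), emap e = h.1 /\ hend (e, h.2) = v.
Proof.
case: h => f b hv; apply: contrapT => noe; have := vdeg_gt0 v.
case: b hv noe; rewrite /hend /= => fv noe.
  rewrite -(harmonic_tgt fv) big1 // => e /andP[/eqP ev /eqP ef].
  by case: noe; exists e.
rewrite -(harmonic_src fv) big1 // => e /andP[/eqP ev /eqP ef].
by case: noe; exists e.
Qed.

Lemma trop_surj (q : gpoint T) : exists p : gpoint (curve C), trop_map p = q.
Proof.
case: q => [y|[[f t] /= tf]].
  by have [v vy] := vmap_surj y; exists (vtx v); rewrite /= vy.
have [v vf] := vmap_surj (src f).
have [e [/= ef _]] := @edge_lift v (f, false) (esym vf).
exists (epoint e (t / (edeg e)%:R)); rewrite trop_epoint ef mulrC divfK.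
  by rewrite (epoint_in tf).
by rewrite pnatr_eq0 -lt0n edeg_gt0.
Qed.

Lemma edeg_sum (f : edge T) : (\sum_(e : edge (curve C) | emap e == f) edeg e = 2)%N.
Proof.
rewrite -(vdeg_sum (src f)).
rewrite (partition_big (@src R (curve C)) (fun v => vmap v == src f)) /=; last first.
  by move=> e /eqP <-; rewrite src_emap.
apply: eq_bigr => v /eqP vf; rewrite -(harmonic_src (esym vf)).
by apply: eq_bigl => e; rewrite andbC.
Qed.

(** Fixing the retraction coordinate at an end of [e] leaves out the open edges over [e], which
    makes the set closed. *)
Definition side_preimage (e : edge T) (b : bool) : set (gpoint (curve C)) :=
  [set p | cut_coord e (trop_map p) = if b then len e else 0].

Definition side_verts (e : edge T) (b : bool) : {set vert (curve C)} :=
  [set v | side e (vmap v) == b]%SET.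

Definition side_edges (e : edge T) (b : bool) : {set edge (curve C)} :=
  [set e' | (emap e' != e) && (side e (vmap (src e')) == b)]%SET.

Lemma side_preimage_vtx e b v : side_preimage e b (vtx v) <-> v \in side_verts e b.
Proof.
rewrite inE /side_preimage /=; have := len_gt0 e => l0.
by case: side; case: b; split=> //= /eqP; rewrite ?(gt_eqF l0) ?(lt_eqF l0).
Qed.

(** Over [e] only one end of the edge belongs to the set; the inequalities on [t] come from the
    clamping in [epoint]. *)
Lemma side_preimage_epoint e b e' t : side_preimage e b (epoint e' t) <->
  if emap e' == e then (if b then len e' <= t else t <= 0) : Prop
  else e' \in side_edges e b.
Proof.
have d0 : 0 < (edeg e')%:R :> R by rewrite ltr0n edeg_gt0.
have := len_gt0 e => l0.
have connT := @target_connected R C; have bT := @target_genus R C.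
rewrite /side_preimage /= trop_epoint inE; case: eqVneq => [<-|ne]; last first.
  rewrite cut_coord_epoint_neq // src_emap.
  by case: side; case: b; split=> //= /eqP; rewrite ?(gt_eqF l0) ?(lt_eqF l0).
have := len_gt0 e' => l0'; have := len_gt0 (emap e') => l1.
have [t0|t0] := leP t 0.
  rewrite epoint_le0 ?pmulr_rle0 //= side_src.
  by case: b; split=> //; lra.
have [tl|tl] := leP (len e') t.
  rewrite epoint_ge_len ?len_emap ?ler_pM2l //= side_tgt //.
  by case: b; rewrite -?len_emap; split => //; lra.
have lt : (edeg e')%:R * t < len (emap e') by rewrite len_emap ltr_pM2l.
have gt : 0 < (edeg e')%:R * t by rewrite mulr_gt0.
rewrite cut_coord_epoint //; last lra.
by case: b; split => //; lra.
Qed.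

Lemma side_preimage_closed e b : closed (side_preimage e b).
Proof.
rewrite -[side_preimage e b]setCK; apply: open_closedC; rewrite gpoint_openE => e'.
have [ee'|ne] := eqVneq (emap e') e.
  rewrite (_ : _ @^-1` _ = if b then [set t | t < len e'] else [set t | 0 < t]).
    by case: b; [exact: open_lt|exact: open_gt].
  apply/seteqP; split => t /=; rewrite side_preimage_epoint ee' eqxx;
  by case: b => /=; [rewrite ltNge|rewrite ltNge] => /negP.
case: (boolP (e' \in side_edges e b)) => e's.
  rewrite (_ : _ @^-1` _ = set0); first exact: open0.
  by rewrite -subset0 => t /=; rewrite side_preimage_epoint (negPf ne).
rewrite (_ : _ @^-1` _ = setT); first exact: openT.
rewrite -subTset => t _ /=; rewrite side_preimage_epoint (negPf ne).
exact/negP.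
Qed.

(** The root [r] is a ramification point over a branch point of that side. As the only point of its
    fibre, it links the sheets of the cover. *)
Lemma side_connected e b : (0 < branch_on e b)%N ->
  exists r, forall v, (v \in side_verts e b) = connect (adj (side_edges e b)) r v.
Proof.
case/card_gt0P => i; rewrite inE => /eqP bi; exists (ram C i) => v.
have rs : ram C i \in side_verts e b by rewrite inE br_ram bi.
apply/idP/idP => [vs|]; last first.
  move=> /(connect_invariant (f := fun w => w \in side_verts e b)) <- //.
  move=> e'; rewrite !inE => /andP[ne _].
  by rewrite -src_emap -tgt_emap side_edge.
(* Having the whole fibre reached from the root passes across each target edge other than [e],
   because every vertex of a fibre is an end of some lift of that edge. *)
pose good z := (side e z != b) || [forall w, (vmap w == z) ==>
  connect (adj (side_edges e b)) (ram C i) w].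
have gbr : good (br C i).
  rewrite /good bi eqxx /=; apply/forallP => w; apply/implyP => /eqP wi.
  (* the ramification point is the only one over its image *)
  suff -> : w = ram C i by exact: connect0.
  apply/eqP/negPn/negP => nw; have := vdeg_sum (br C i).
  rewrite (bigD1 (ram C i)) ?br_ram //= vdeg_ram (bigD1 w) /=; last by rewrite wi eqxx.
  by have := vdeg_gt0 w; lia.
have : good (vmap v).
  have sv : side e (br C i) = side e (vmap v) by move: vs; rewrite inE bi => /eqP->.
  rewrite -(connect_invariant (f := good) _ (side_connect (@target_connected R C) sv)) // => f.
  rewrite !inE => ne; rewrite /good (side_edge ne).
  case: eqP => //= sf.
  apply/forallP/forallP => gd w; apply/implyP => /eqP wf.
    have [e' [ef /= ew]] := @edge_lift w (f, true) (esym wf).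
    rewrite -ew /hend /= -connect_edge.
      by apply: (implyP (gd _)); rewrite -src_emap ef.
    by rewrite inE -src_emap ef ne side_edge ?sf /=.
  have [e' [ef /= ew]] := @edge_lift w (f, false) (esym wf).
  rewrite -ew /hend /= connect_edge.
    by apply: (implyP (gd _)); rewrite -tgt_emap ef.
  by rewrite inE -src_emap ef ne side_edge ?sf /=.
rewrite /good; move: vs; rewrite inE => -> /= /forallP/(_ v).
by rewrite eqxx.
Qed.

Lemma side_preimage_cover e b p : side_preimage e b p ->
  (exists2 v, v \in side_verts e b & p = vtx v) \/
  (exists2 e', e' \in side_edges e b & exists t, p = epoint e' t).
Proof.
case: p => [v /side_preimage_vtx|[[e' t] te]]; first by left; exists v.
rewrite -(epoint_in te) side_preimage_epoint; case: eqP => [|_] ?.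
  by move: te => /=; case: b => ?; lra.
by right; exists e' => //; exists t.
Qed.

(** A nonempty relatively clopen subset [B] contains each edge that it meets, as the real line is
    connected; it then contains all vertices by [side_connected]. *)
Lemma side_preimage_connected e b : (0 < branch_on e b)%N ->
  connected (side_preimage e b).
Proof.
move=> b0; have [r rE] := side_connected b0.
move=> B [p Bp] [U oU BU] [D cD BD].
have F_in e' t : e' \in side_edges e b -> side_preimage e b (epoint e' t).
  move=> e's; rewrite side_preimage_epoint e's.
  by move: e's; rewrite inE; case: eqP.
have segment e' s t : e' \in side_edges e b -> B (epoint e' s) -> B (epoint e' t).
  move=> e's Bs.
  have BR : epoint e' @^-1` B = setT.
    have connR : connected [set: R] by apply/connected_intervalP => ? ? _ _ ?.
    apply: connR; first by exists s.
      exists (epoint e' @^-1` U); first by move: oU; rewrite gpoint_openE; exact.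
      by rewrite setTI BU; apply/seteqP; split => u /= => [[]//|]; split=> //; exact: F_in.
    exists (epoint e' @^-1` D).
      rewrite -[_ @^-1` D]setCK preimage_setC; apply: open_closedC.
      by move: (closed_openC cD); rewrite gpoint_openE; exact.
    by rewrite setTI BD; apply/seteqP; split => u /= => [[]//|]; split=> //; exact: F_in.
  by have : [set: R] t by []; rewrite -BR.
have BvtxE e' : e' \in side_edges e b ->
    `[< B (vtx (src e')) >] = `[< B (vtx (tgt e')) >].
  move=> e's; apply: asbool_equiv_eq; rewrite -(@epoint_le0 _ _ e' 0) //.
  by rewrite -(@epoint_ge_len _ _ e' (len e')) //; split; exact: segment.
have [v vs Bv] : exists2 v, v \in side_verts e b & B (vtx v).
  have Sp : side_preimage e b p by move: Bp; rewrite BU => -[].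
  case: (side_preimage_cover Sp) => [[v vs pv]|[e' e's [t pt]]].
    by exists v; rewrite -?pv.
  exists (src e'); first by move: e's; rewrite !inE => /andP[].
  by rewrite -(@epoint_le0 _ _ e' 0) //; apply: (segment _ t); rewrite -?pt.
have allB w : w \in side_verts e b -> B (vtx w).
  move: vs; rewrite !rE => rv rw.
  have inv := connect_invariant (f := fun u => `[< B (vtx u) >]) BvtxE.
  by apply/asboolP; rewrite -(inv _ _ rw) (inv _ _ rv); apply/asboolP.
apply/seteqP; split => q; first by rewrite BU => -[].
case/side_preimage_cover => [[w ws ->]|[e' e's [t ->]]]; first exact: allB.
apply: (segment _ 0) => //; rewrite epoint_le0 //; apply: allB.
by move: e's; rewrite !inE => /andP[].
Qed.

(** Riemann-Hurwitz is summed over the side. Both target counts obey vertices = edges + 1, so twice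
    the genus is [branch_on e b - 2] plus the excess ramification over [e]. *)
Lemma side_genus e b : (5 <= branch_on e b)%N ->
  genus_of (@vgenus R C) (side_preimage e b) = 2%N.
Proof.
move=> b5; have [r rE] := side_connected (leq_trans (isT : 0 < 5)%N b5).
have connT := @target_connected R C; have bT := @target_genus R C.
rewrite /genus_of.
rewrite (_ : [set v | _]%SET = side_verts e b); last first.
  apply/setP => v; rewrite [LHS]inE; apply/asboolP/idP; by rewrite side_preimage_vtx.
rewrite (_ : [set e' | _]%SET = side_edges e b); last first.
  (* The midpoint of an edge over [e] witnesses that this edge is not contained in the set. *)
  apply/setP => e'; rewrite [LHS]inE; apply/asboolP/idP => [/(_ (len e' / 2))|e's t].
    rewrite side_preimage_epoint; case: eqP => // _.
    by move=> h; exfalso; move: h (len_gt0 e'); clear; case: b; lra.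
  by rewrite side_preimage_epoint e's; move: e's; rewrite inE; case: eqP.
rewrite /arith_genus /betti1 (n_comp_connected rE).
have leW : (#|side_verts e b| <= #|side_edges e b|.+1)%N.
  by apply: (@card_connected_edges _ _ _ _ r) => [|v]; rewrite rE ?connect0.
have sum_vdeg : (\sum_(v in side_verts e b) vdeg v = 2 * #|verts_on e b|)%N.
  rewrite (partition_big (@vmap R C) (mem (verts_on e b))) /=; last first.
    by move=> v; rewrite !inE.
  rewrite mulnC -sum_nat_const; apply: eq_bigr => y; rewrite inE => /eqP sy.
  rewrite -[RHS](vdeg_sum y); apply: eq_bigl => v; rewrite inE.
  by case: (vmap v =P y) => [->|]; rewrite ?sy ?eqxx ?andbF.
have sum_edeg : (\sum_(e' in side_edges e b) edeg e' = 2 * #|edges_on e b|)%N.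
  rewrite (partition_big (@emap R C) (mem (edges_on e b))) /=; last first.
    by move=> e'; rewrite !inE src_emap.
  rewrite mulnC -sum_nat_const; apply: eq_bigr => f; rewrite inE => /andP[ne /eqP sf].
  rewrite -[RHS](edeg_sum f); apply: eq_bigl => e'; rewrite inE -src_emap.
  by case: (emap e' =P f) => [->|]; rewrite ?ne ?sf ?eqxx ?andbF.
have sum_ram : (\sum_(v in side_verts e b) #|[set i | ram C i == v]%SET| = branch_on e b)%N.
  rewrite /branch_on -sum1_card (partition_big (ram C) (mem (side_verts e b))) /=; last first.
    by move=> i; rewrite !inE br_ram.
  apply: eq_bigr => v; rewrite inE => /eqP sv; rewrite -sum1_card.
  apply: eq_bigl => i; rewrite !inE -br_ram.
  by case: (ram C i =P v) => [->|]; rewrite ?sv ?eqxx ?andbF.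
pose ex (e' : edge (curve C)) := (edeg e' - 1)%N.
have sum_ex : (\sum_(e' in side_edges e b) ex e' + #|side_edges e b| =
    \sum_(e' in side_edges e b) edeg e')%N.
  rewrite -sum1_card -big_split /=; apply: eq_bigr => e' _.
  by rewrite /ex subnK // edeg_gt0.
(* The degrees over [e] add up to two and at least one edge lies over [e]. *)
have ex_e : (\sum_(e' | emap e' == e) ex e' <= 1)%N.
  have : (\sum_(e' | emap e' == e) ex e' + #|[pred e' | emap e' == e]| = 2)%N.
    rewrite -sum1_card -big_split /= -[RHS](edeg_sum e); apply: eq_bigr => e' _.
    by rewrite /ex subnK // edeg_gt0.
  suff : (0 < #|[pred e' | emap e' == e]|)%N by lia.
  have [v ve] := vmap_surj (src e).
  have [e' [ee' _]] := @edge_lift v (e, false) (esym ve).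
  by apply/card_gt0P; exists e'; rewrite inE ee'.
(* An edge of the side is seen from both of its ends, an edge over [e] from one end only. *)
have sum_h : (\sum_(v in side_verts e b) \sum_(h : halfedge (curve C) | hend h == v) ex h.1 =
   2 * (\sum_(e' in side_edges e b) ex e') + \sum_(e' | emap e' == e) ex e')%N.
  transitivity (\sum_(h : halfedge (curve C) | side e (vmap (hend h)) == b) ex h.1)%N.
    rewrite [RHS](partition_big (@hend R (curve C)) (mem (side_verts e b))) /=; last first.
      by move=> h; rewrite inE.
    apply: eq_bigr => v; rewrite inE => /eqP sv; apply: eq_bigl => h.
    by case: (hend h =P v) => [->|]; rewrite ?sv ?eqxx ?andbF.
  rewrite big_mkcond (eq_bigr (fun h : halfedge (curve C) => (fun e' b' =>
    if side e (vmap (hend (e', b'))) == b then ex e' else 0%N) h.1 h.2)); last by case.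
  rewrite -(pair_bigA _ (fun e' b' =>
    if side e (vmap (hend (e', b'))) == b then ex e' else 0%N)) /=.
  rewrite [\sum_(e' in _) _]big_mkcond [\sum_(e' | emap e' == e) _]big_mkcond.
  rewrite mul2n -addnn -!big_split /=.
  apply: eq_bigr => e' _; rewrite big_bool /hend /= -src_emap -tgt_emap inE -src_emap.
  case: (eqVneq (emap e') e) => [->|ne] /=.
    by rewrite side_src side_tgt //; case: (b); rewrite /= ?addn0.
  by rewrite (side_edge ne) addn0; case: eqP.
have rh : (\sum_(v in side_verts e b) ((vgenus v).*2 + (vdeg v).*2) =
   \sum_(v in side_verts e b) (2 + #|[set i | ram C i == v]%SET| +
     \sum_(h : halfedge (curve C) | hend h == v) ex h.1))%N.
  by apply: eq_bigr => v _; exact: riemann_hurwitz.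
move: rh; rewrite !big_split /= sum_h sum_ram sum_nat_const.
have dbl (g : vert (curve C) -> nat) :
    (\sum_(v in side_verts e b) (g v).*2 = (\sum_(v in side_verts e b) g v).*2)%N.
  by rewrite -mul2n big_distrr /=; apply: eq_bigr => v _; rewrite mul2n.
rewrite !dbl sum_vdeg; have := card_side connT bT e b.
(* With five or six branch points and excess at most one, parity leaves 4 as the only value of twice
   the genus. *)
have : (branch_on e b <= 6)%N by have := branch_on_sum e; case: (b); lia.
move: sum_edeg sum_ex ex_e leW b5; lia.
Qed.

(** Of the six branch points at least five lie on side [b], so its preimage is a subcurve of genus
    two and minimality of the core applies. *)
Lemma core_side core e b : core_of (@vgenus R C) core ->
  (branch_on e (~~ b) <= 1)%N -> core `<=` side_preimage e b.
Proof.
move=> [_ _ _ mincore] le1.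
have b5 : (5 <= branch_on e b)%N.
  by have := branch_on_sum e; case: b le1 => /=; lia.
have b0 : (0 < branch_on e b)%N by exact: leq_trans b5.
apply: mincore; [split|exact: side_genus|exact: sub0set].
- have [r rE] := side_connected b0.
  by exists (vtx r); apply/side_preimage_vtx; rewrite rE connect0.
- exact: side_preimage_closed.
- exact: side_preimage_connected.
Qed.

End CoverGeometry.

(** * Directions in which the edges between two points of a tree are crossed *)

Section Separation.
Context {R : realType} (G : mgraph R).
Hypothesis connG : graph_connected G.
Hypothesis bettiG : betti1 [set: vert G]%SET [set: edge G]%SET = 0%N.

(* Going from p to q, the edge e is (partially) crossed towards the side of v. *)
Definition crossed_towards (e : edge G) (v : vert G) (p q : gpoint G) : bool :=
  if side e v then cut_coord e p < cut_coord e q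
  else cut_coord e q < cut_coord e p.

Lemma crossed_towards_neq e v p q : crossed_towards e v p q -> p != vtx v.
Proof.
rewrite /crossed_towards; case: (boolP (side e v)) => sv; apply: contraTneq => -> /=.
  by rewrite sv -leNgt cut_coord_le.
by rewrite (negPf sv) -leNgt cut_coord_ge0.
Qed.

Definition point_base (p : gpoint G) : vert G :=
  match p with inl v => v | inr i => src (val i).1 end.

(** The right-hand side does not involve [v]: seen from [p], all vertices towards which some edge is
    crossed on the way to [q] lie in the same direction as [q]. *)
Lemma crossed_towards_side e v p q e' b : crossed_towards e v p q ->
  (e', b) \in tangent p ->
  side e' v = if cut_coord e' p < cut_coord e' q then true
              else if cut_coord e' q < cut_coord e' p then false
              else side e' (point_base q).
Proof.
move=> cr tan.
have [ee'|ne] := eqVneq e' e.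
  move: cr; rewrite ee' /crossed_towards; case: side => [->//|cr].
  by rewrite cr ltNge (ltW cr).
have len0 := len_gt0 e; have len0' := len_gt0 e'.
(* Since [e'] touches [p] and differs from [e], the point [p] retracts to the end of [e] on the side
   of [e']. Hence [v] is on the opposite side. *)
have cutp : cut_coord e p = if side e (src e') then len e else 0.
  case: p tan {cr} => [w|i]; rewrite inE /=; last first.
    by move=> /eqP <-; rewrite (negPf ne).
  by rewrite /hend /= => /eqP <-; case: b; rewrite -?side_edge.
have vNe' : side e v != side e (src e').
  move: cr; rewrite /crossed_towards cutp; case: side; case: side => // cr.
    by have := cut_coord_le e q; rewrite leNgt cr.
  by have := cut_coord_ge0 e q; rewrite leNgt cr.
have near_v w : cut_coord e q = (if side e w then len e else 0) -> side e v = side e w.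
  move: cr vNe'; rewrite /crossed_towards cutp.
  by case: side; case: side => // cr _ cq; move: cr; rewrite cq; case: side => //;
     rewrite ltxx.
have [vq cutq] : side e' v = side e' (point_base q) /\
    cut_coord e' q = if side e' (point_base q) then len e' else 0.
  case: q cr near_v => [w|[[e2 t] te]] cr near_v /=; split => //.
  - exact/(side_nested connG ne _ vNe')/near_v.
  - have [e2e|ne2] := eqVneq e2 e.
      (* When [q] is inside [e], the end of [e] towards [v] serves for the comparison. *)
      subst e2; rewrite (@side_nested _ _ connG e e' v (hend (e, side e v))) //.
        rewrite /hend /=; case: ifP => // _.
        by rewrite -side_edge // eq_sym.
      by rewrite (side_hend connG bettiG (e, side e v)).
    apply: (side_nested connG ne _ vNe'); apply: near_v.
    by rewrite /= (negPf ne2).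
  - case: eqVneq => // e2e'; subst e2; move: cr.
    by rewrite /crossed_towards cutp /= (negPf ne) !ltxx; case: ifP.
rewrite vq; case: ltP => [|_].
  by rewrite cutq; case: side => //; rewrite ltNge cut_coord_ge0.
case: ltP => // ; rewrite cutq; case: side => //.
by rewrite ltNge cut_coord_le.
Qed.

End Separation.

(** * Growth of admissible functions towards the core, and their maximum near a point *)

Section Special.
Context {R : realType} (C : admissible_cover R).
Local Notation T := (target C).

Lemma core_branch core y (e : edge T) b : core_of (@vgenus R C) core -> core y ->
  cut_coord e (trop_map y) != (if b then 0 else len e) -> (2 <= branch_on e b)%N.
Proof.
move=> hcore ycore ne; rewrite ltnNge; apply: contra ne => le1.
have := @core_side _ _ core e (~~ b) hcore; rewrite negbK => /(_ le1 y ycore).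
by rewrite /side_preimage /= => ->; case: b {le1}.
Qed.

(** By [affine_cut_sum] the difference is a sum over edges. Each one actually crossed is crossed
    away from [v0], with at least two branch points beyond, so its term is nonnegative. *)
Lemma admissible_le core y v0 (f : gpoint T -> R) p :
  core_of (@vgenus R C) core -> core y -> admissible_fun v0 f ->
  (forall e, ~~ crossed_towards e v0 p (trop_map y)) -> f p <= f (trop_map y).
Proof.
move=> hcore ycore admf nocross; rewrite -subr_ge0.
rewrite (affine_cut_sum _ _ (@target_connected R C) (@target_genus R C)
  (admissible_affine admf)).
apply: sumr_ge0 => e _; rewrite (admissible_slope e admf).
have := nocross e; rewrite /crossed_towards.
(* The total of six turns the slope [2 - b/2] seen from one side into [b/2 - 1] for the count on the
   other. *)
have b6 : (branch_on e false)%:R + (branch_on e true)%:R = 6 :> R.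
  by rewrite -natrD branch_on_sum.
have bgt b : cut_coord e (trop_map y) != (if b then 0 else len e) ->
    2 <= (branch_on e b)%:R :> R.
  by move=> /(core_branch hcore ycore); rewrite ler_nat.
case: side => /=; rewrite -leNgt => le_pq.
  have [->|ne] := eqVneq (cut_coord e (trop_map y)) (cut_coord e p).
    by rewrite subrr mulr0.
  have lt : cut_coord e (trop_map y) < cut_coord e p by rewrite lt_neqAle ne.
  have := bgt false; rewrite lt_eqF; last exact: lt_le_trans lt (cut_coord_le e p).
  move=> /(_ isT) b2; rewrite mulr_le0 //; lra.
have [->|ne] := eqVneq (cut_coord e (trop_map y)) (cut_coord e p).
  by rewrite subrr mulr0.
have lt : cut_coord e p < cut_coord e (trop_map y) by rewrite lt_neqAle eq_sym ne.
have := bgt true; rewrite gt_eqF; last exact: le_lt_trans (cut_coord_ge0 e p) lt.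
move=> /(_ isT) b2; rewrite mulr_ge0 //; lra.
Qed.

Lemma near_affine_gt0 (c m : R) : 0 < c -> \forall t \near 0^'+, 0 < c + m * t.
Proof.
move=> c0; have m0 : 0 < `|m| + 1 by rewrite ltr_wpDl.
apply: (@near_right0 _ (c / (`|m| + 1))); first by rewrite divr_gt0.
move=> t /andP[t0]; rewrite ltr_pdivlMr // => tc.
have : - (`|m| * t) <= m * t by rewrite -mulNr ler_wpM2r ?(ltW t0) // lerNl ler_normr lexx orbT.
rewrite mulrDr mulr1 mulrC in tc; lra.
Qed.

Variable lam : vert T -> gpoint T -> R.
Hypothesis hadm : forall v0, admissible_fun v0 (lam v0).

Lemma lam_le_lambdaT v0 p : lam v0 p <= lambdaT lam p.
Proof. exact: le_bigmax. Qed.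

Lemma lambdaT_ge0 p : 0 <= lambdaT lam p.
Proof. exact: bigmax_ge_id. Qed.

Lemma lambdaT_attained p : 0 < lambdaT lam p -> exists v0, lam v0 p = lambdaT lam p.
Proof.
move=> l0; apply: contrapT => none; have := ltxx (lambdaT lam p).
rewrite [X in X < _]/lambdaT => /negbT/negP; apply; apply/bigmax_ltP; split=> // v _.
rewrite lt_neqAle lam_le_lambdaT andbT; apply/eqP => lv.
by apply: none; exists v.
Qed.

(* If all functions attaining the maximum at p have the same slopes there, then
   the maximum agrees near p with any of them. *)
Lemma lambdaT_near p v0 h : h \in tangent p -> 0 < lambdaT lam p ->
  lam v0 p = lambdaT lam p ->
  (forall v, lam v p = lambdaT lam p -> side h.1 v = side h.1 v0) ->
  \forall t \near 0^'+, lambdaT lam (move_to p h t) = lam v0 (move_to p h t).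
Proof.
move=> hp l0 lv0 same.
have mv v := affine_move (admissible_affine (hadm v)) hp.
have dom : \forall t \near 0^'+, forall v,
    lam v (move_to p h t) <= lam v0 (move_to p h t).
  apply: filter_forall => v; have [lv|lv] := eqVneq (lam v p) (lambdaT lam p).
    have eqs : hslope (lam v) h = hslope (lam v0) h.
      (* The slope formula depends on the vertex only through its side. *)
      by rewrite /hslope !(admissible_slope _ (hadm _)) same.
    near=> t.
    have -> : lam v (move_to p h t) = lam v p + hslope (lam v) h * t by near: t; exact: mv.
    have -> : lam v0 (move_to p h t) = lam v0 p + hslope (lam v0) h * t by near: t; exact: mv.
    by rewrite eqs lv lv0.
  have gt0 : 0 < lam v0 p - lam v p.
    by rewrite subr_gt0 lv0 lt_neqAle lv lam_le_lambdaT.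
  near=> t.
  have -> : lam v (move_to p h t) = lam v p + hslope (lam v) h * t by near: t; exact: mv.
  have -> : lam v0 (move_to p h t) = lam v0 p + hslope (lam v0) h * t by near: t; exact: mv.
  have : 0 < lam v0 p - lam v p + (hslope (lam v0) h - hslope (lam v) h) * t.
    by near: t; exact: near_affine_gt0.
  by rewrite mulrBl; lra.
near=> t; apply/le_anti; rewrite lam_le_lambdaT andbT; apply/bigmax_leP; split.
  (* The base value 0 of the maximum is dominated too, because [lam v0] is positive near [p]. *)
  have -> : lam v0 (move_to p h t) = lam v0 p + hslope (lam v0) h * t by near: t; exact: mv.
  apply: ltW; near: t; apply: near_affine_gt0; by rewrite lv0.
move=> v _; have : forall v, lam v (move_to p h t) <= lam v0 (move_to p h t) by near: t.
exact.
Unshelve. all: by end_near. Qed.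

(** Near [p] the maximum is [lam v0] and is positive. Its slopes are therefore those of [lam v0],
    and every direction at [p] stays in the image of [Delta], so that [Dprime] agrees with its value
    on the whole tree. *)
Lemma Ddiv_eq0 (Delta : set (gpoint (curve C))) p v0 :
  is_Delta lam Delta -> 0 < lambdaT lam p ->
  lam v0 p = lambdaT lam p -> p != vtx v0 ->
  (forall h v, h \in tangent p -> lam v p = lambdaT lam p ->
     side h.1 v = side h.1 v0) ->
  Ddiv lam Delta p = 0.
Proof.
move=> [_ _ subD _] l0 lv0 pv0 same.
have aff := admissible_affine (hadm v0).
have near_eq h hp := lambdaT_near hp l0 lv0 (fun v => same h v hp).
have slopeT h : h \in tangent p -> slope_at (lambdaT lam) p h = slope_at (lam v0) p h.
  move=> hp; have mv := affine_move aff hp.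
  rewrite (slope_atE mv); apply: slope_atE; rewrite -lv0.
  by apply: filterS2 (near_eq h hp) mv => t ->.
have full : {in tangent p, forall h, in_dir (@trop_map R C @` Delta) p h}.
  move=> h hp; have := near_affine_gt0 (hslope (lam v0) h) l0; rewrite -lv0 => pos.
  rewrite /in_dir; apply: filterS3 (near_eq h hp) (affine_move aff hp) pos.
  move=> t eqt mvt post; have [x xt] := trop_surj (move_to p h t).
  exists x => //; apply: subD; apply: subset_closure.
  by rewrite /Delta_open /= /lambda xt eqt mvt.
rewrite /Ddiv (Dprime_full full) -(@Dprime_full _ _ setT) => [|h _]; last exact: in_dirT.
rewrite (_ : gdiv _ _ = gdiv (lam v0) p).
  by have [_ ->] := hadm v0; rewrite (negPf pv0).
exact: eq_bigr.
Qed.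

End Special.

Theorem lemma3p22 (R : realType) (C : admissible_cover R)
  (lam : vert (target C) -> gpoint (target C) -> R)
  (hadm : forall v0, admissible_fun v0 (lam v0))
  (hnorm : forall v0, normalized (lam v0))
  (Delta core : set (gpoint (curve C)))
  (hDelta : is_Delta lam Delta)
  (hcore : core_of (@vgenus R C) core)
  (rho1 : R)
  (hrho1 : exists2 x, special lam Delta x & lambda lam x = rho1) :
  core `<=` [set x | rho1 <= lambda lam x].
Proof.
case: hrho1 => x [_ Dx] <- y ycore; rewrite /= /lambda leNgt; apply/negP => lt.
set p := trop_map x in Dx lt *; set q := trop_map y in lt *.
have l0 : 0 < lambdaT lam p by apply: le_lt_trans lt; exact: lambdaT_ge0.
(* Without such an edge, [lam v] would not decrease from [p] to [q], contradicting the assumed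
   strict inequality. *)
have crossed v : lam v p = lambdaT lam p -> exists e, crossed_towards e v p q.
  move=> lv; apply: contrapT => nocross; move: lt; rewrite ltNge => /negP; apply.
  rewrite -lv; apply: le_trans (lam_le_lambdaT lam v q).
  apply: (admissible_le hcore ycore (hadm v)) => e.
  by apply/negP => cr; apply: nocross; exists e.
have [v0 lv0] := lambdaT_attained l0; have [e0 cr0] := crossed _ lv0.
apply: Dx; apply: (Ddiv_eq0 hadm hDelta l0 lv0 (crossed_towards_neq cr0)).
move=> [e b] v hp /crossed[e1 cr1] /=.
have sideE := crossed_towards_side (@target_connected R C) (@target_genus R C).
by rewrite (sideE _ _ _ _ _ _ cr1 hp) (sideE _ _ _ _ _ _ cr0 hp).
Qed.
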